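(* Let $\mathcal{I}=\{I_1,\dots,I_p\}$ be a partition of $D=\{1,\dots,d\}$ and let $\lambda=(\lambda_1,\dots,\lambda_p)\in(0,\infty)^p$. Let $\mathbf{X}=(X_1,\dots,X_d)$, $\hat{\mathbf{X}}=(\hat X_1,\dots,\hat X_d)$ and $\bar{\mathbf{X}}=(\bar X_1,\dots,\bar X_d)$ be vectors of unit Fréchet random variables with Multivariate Extreme Value (MEV) distributions such that the subvectors $\hat{\mathbf{X}}_{I_j}$, $j=1,\dots,p$, are independent, the subvectors $\bar{\mathbf{X}}_{I_j}$, $j=1,\dots,p$, are totally dependent, and, for each $j=1,\dots,p$, the vectors $\hat{\mathbf{X}}_{I_j}$, $\bar{\mathbf{X}}_{I_j}$ and $\mathbf{X}_{I_j}$ are identically distributed. Then: (a) $R(\bar{\mathbf{X}},\lambda,\mathcal{I})\le R(\mathbf{X},\lambda,\mathcal{I})\le R(\hat{\mathbf{X}},\lambda,\mathcal{I})$; (b) $R(\bar{\mathbf{X}},\mathbf{1},\mathcal{I})=0$; (c) $$R(\hat{\mathbf{X}},\mathbf{1},\mathcal{I})=\frac{\sum_{j=1}^p\epsilon_{\mathbf{X}_{I_j}}}{1+\sum_{j=1}^p\epsilon_{\mathbf{X}_{I_j}}}-\sum_{\emptyset\neq T\subseteq\{1,\dots,p\}}(-1)^{|T|+1}\,\frac{\sum_{j\in T}\epsilon_{\mathbf{X}_{I_j}}}{1+\sum_{j\in T}\epsilon_{\mathbf{X}_{I_j}}},$$ where $\mathbf{1}=(1,\dots,1)\in(0,\inf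ty)^p$.
   Context: Unit Fréchet random variables have distribution function $F(x)=\exp(-x^{-1})$, $x>0$. A Multivariate Extreme Value (MEV) distribution is a max-stable distribution function with non-degenerate margins; for an MEV distribution $G$ with unit Fréchet margins this means $G(tx_1,\dots,tx_d)^t=G(x_1,\dots,x_d)$ for all $t>0$ and all $x_1,\dots,x_d>0$. A partition $\mathcal{I}=\{I_1,\dots,I_p\}$ of $D$ consists of nonempty, pairwise disjoint sets with union $D$. For nonempty $S\subseteq D$, $\mathbf{X}_S$ denotes the subvector of $\mathbf{X}$ with indices in $S$ (similarly for $\hat{\mathbf{X}}$, $\bar{\mathbf{X}}$). The subvectors $\bar{\mathbf{X}}_{I_1},\dots,\bar{\mathbf{X}}_{I_p}$ are totally dependent if they are joined by the minimum copula, i.e. $$P\left(\bigcap_{i=1}^d\{\bar X_i\le x_i\}\right)=\min_{1\le j\le p}P\left(\bigcap_{i\in I_j}\{\bar X_i\le x_i\}\right)\quad\text{for all }(x_1,\dots,x_d)\in\mathbb{R}^d.$$ The max-min dependence coefficient of a vector $\mathbf{Z}=(Z_1,\dots,Z_d)$ of unit Fréchet variables with MEV distribution is, for $\lambda\in(0,\infty)^p$, $$R(\mathbf{Z},\lambda,\mathcal{I})=E\left(\max_{1\le j\le p}F^{\lambda_j}\Big(\max_{i\in I_j}Z_i\Big)-\min_{1\le j\le p}F^{\lambda_j}\Big(\max_{i\in I_j}Z_i\Big)\right),$$ where $F^{\lambda}(x)=(F(x))^{\lambda}$. The extremal coefficient $\epsilon_{\mathbf{X}_S}$ of $\mathbf{X}_S$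 is $\epsilon_{\mathbf{X}_S}=-\log P\left(X_i\le 1\text{ for all }i\in S\right)$, i.e. the value $l(\delta_1(S),\dots,\delta_d(S))$ of the tail dependence function $l(x_1,\dots,x_d)=-\log P(X_1\le x_1^{-1},\dots,X_d\le x_d^{-1})$ (with $0^{-1}=+\infty$), where $\delta_i(S)=1$ if $i\in S$ and $0$ otherwise. *)

(* Defs.v *)
From HB Require Import structures.
From mathcomp Require Import all_boot all_order all_algebra.
From mathcomp Require Import all_classical all_reals all_analysis.

Set Implicit Arguments.
Unset Strict Implicit.
Unset Printing Implicit Defensive.

Import Order.TTheory GRing.Theory Num.Theory.
Import numFieldNormedType.Exports.

Local Open Scope classical_set_scope.
Local Open Scope ring_scope.

(* An indexed partition I_1, ..., I_p of {1, ..., d}, coded as 'I_d. *)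
Definition is_partition (d p : nat) (I : 'I_p -> {set 'I_d}) : Prop :=
  [/\ forall j, I j != finset.set0,
      forall j k, j != k -> (I j :&: I k)%SET = finset.set0
    & (\bigcup_(j < p) I j)%SET = [set: 'I_d]%SET].

Definition frechet_cdf (R : realType) (x : R) : R :=
  if 0 < x then expR (- x^-1) else 0.

Section RandomVectors.
Context (disp : measure_display) (T : measurableType disp) (R : realType)
        (P : probability T R) (d : nat).
Implicit Types (Z : 'I_d -> {RV P >-> R}) (S : {set 'I_d}).

Definition joint_cdf Z (x : 'I_d -> R) : \bar R :=
  P [set w | forall i, Z i w <= x i].

(* The distribution function of Z_S; only the x i with i \in S matter. *)
Definition sub_cdf Z S (x : 'I_d -> R) : \bar R :=
  P [set w | forall i, i \in S -> Z i w <= x i].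

(* Z_S, its coordinates being listed in increasing order of the indices. *)
Definition subvec Z S (w : T) : #|S|.-tuple R :=
  [tuple Z (enum_val k) w | k < #|S|].

Definition unit_frechet (Y : {RV P >-> R}) : Prop :=
  forall x : R, cdf Y x = (frechet_cdf x)%:E.

(* Max-stability in the form it takes for unit Frechet margins:
   G(t x)^t = G(x). *)
Definition max_stable Z : Prop :=
  forall (t : R) (x : 'I_d -> R), 0 < t -> (forall i, 0 < x i) ->
    fine (joint_cdf Z (fun i => t * x i)) `^ t = fine (joint_cdf Z x).

Definition unit_frechet_MEV Z : Prop :=
  (forall i, unit_frechet (Z i)) /\ max_stable Z.

Definition extremal_coef Z S : R := - ln (fine (sub_cdf Z S (fun=> 1))).

Section Blocks.
Context (p : nat) (I : 'I_p -> {set 'I_d}).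

(* The B j may be taken to be the whole space, so the product rule for every
   subfamily of blocks is included. *)
Definition independent_blocks Z : Prop :=
  forall B : (forall j : 'I_p, set (#|I j|.-tuple R)),
    (forall j, measurable (B j)) ->
    P [set w | forall j, B j (subvec Z (I j) w)] =
    (\prod_(j < p) P [set w | B j (subvec Z (I j) w)])%E.

(* +oo is the neutral element of the minimum. *)
Definition totally_dependent_blocks Z : Prop :=
  forall x : 'I_d -> R,
    joint_cdf Z x = \big[Order.min/+oo%E]_(j < p) sub_cdf Z (I j) x.

(* F^(lambda_j) (max_(i in I_j) Z_i).  Starting the maximum at 0 is harmless:
   frechet_cdf vanishes on all x <= 0. *)
Definition block_margin Z (lambda : 'I_p -> R) (j : 'I_p) (w : T) : R :=
  frechet_cdf (\big[Num.max/0]_(i in I j) Z i w) `^ lambda j.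

(* The values of block_margin lie in [0, 1] (for lambda j > 0), so that the
   default values 0 and 1 do not affect the maximum and the minimum when
   p > 0. *)
Definition max_min_coef Z (lambda : 'I_p -> R) : \bar R :=
  ('E_P[fun w => (\big[Num.max/0]_(j < p) block_margin Z lambda j w -
                  \big[Num.min/1]_(j < p) block_margin Z lambda j w)%R])%E.

End Blocks.
End RandomVectors.

(* Z_S and Z'_S, possibly on different probability spaces, have the same law. *)
Definition eq_law_on (disp disp' : measure_display)
    (T : measurableType disp) (T' : measurableType disp') (R : realType)
    (P : probability T R) (P' : probability T' R) (d : nat)
    (Z : 'I_d -> {RV P >-> R}) (Z' : 'I_d -> {RV P' >-> R})
    (S : {set 'I_d}) : Prop :=
  forall B : set (#|S|.-tuple R), measurable B ->
    P [set w | B (subvec Z S w)] = P' [set w | B (subvec Z' S w)].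

(* Main.v *)
Require Import Defs.
From HB Require Import structures.
From mathcomp Require Import all_boot all_order all_algebra.
From mathcomp Require Import all_classical all_reals all_analysis.
From mathcomp Require Import measurable_realfun ring lra.

Set Implicit Arguments.
Unset Strict Implicit.
Unset Printing Implicit Defensive.

Import Order.TTheory GRing.Theory Num.Theory.
Import numFieldNormedType.Exports.

Local Open Scope classical_set_scope.
Local Open Scope ring_scope.

(**
  At level u, let A_j be the event that the j-th block margin is at most u, that
  is X_i <= lambda_j / (- ln u) for all i in I_j. By the layer-cake formula
  R is the integral over u in ]0, 1[ of
  1 - P(all A_j occur) - P(no A_j occurs),
  so both inequalities of (a) reduce to comparisons of these two probabilities.

  Upper bound. Write P(all A_j, j in S, occur) = exp (- V S). Max-stability gives
  the same identity with V S / n at levels multiplied by n; hence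
  n (1 - exp (- V S / n)) is n times the probability that the random set of
  blocks exceeding these levels meets S, a sum of nonnegative masses nu_n B over
  the sets B meeting S. For such a functional in place of V, the
  inclusion-exclusion sums all_hit are supermultiplicative (add the masses one
  at a time and use Chebyshev's inequality); let n tend to infinity.

  Lower bound. The blocks of Xbar being totally dependent, the events A_j form a
  chain up to null sets. Moreover, if i and k lie in different blocks then
  P(Xbar_i <= c, Xbar_k <= c) = P(Xbar_i <= c), so Xbar_i = Xbar_k almost
  surely; for lambda = 1, where all the levels coincide, this yields (b).

  For (c), P(A_j) = u ^ eps_j, and the integrand is a combination of powers of u.
*)

(** * Inclusion-exclusion and hitting functionals *)

Lemma prod_1B (R : comNzRingType) (I : finType) (a : I -> R) :
  \prod_i (1 - a i) = \sum_(S : {set I}) (-1) ^+ #|S| * \prod_(i in S) a i.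
Proof.
under eq_bigr do rewrite addrC.
rewrite bigA_distr; apply: eq_bigr => S _.
rewrite [in RHS]big_mkcond -(prodr_const (mem S)) [X in X * _]big_mkcond -big_split.
by apply: eq_bigr => i _ /=; case: ifP; rewrite ?mulN1r ?mulr1.
Qed.

(** Put the indicator of [B] for [a] in [prod_1B]: only subsets of [B] survive in the expansion,
    while a single element of [B] makes the product vanish. *)
Lemma sum_sign_subset (R : comNzRingType) (I : finType) (B : {set I}) :
  \sum_(S : {set I} | S \subset B) (-1) ^+ #|S| = (B == finset.set0)%:R :> R.
Proof.
transitivity (\prod_i (1 - (i \in B)%:R) : R).
  rewrite prod_1B big_mkcond; apply: eq_bigr => S _.
  case: ifPn => [/fintype.subsetP SB|/fintype.subsetPn[i iS iB]].
    by rewrite big1 ?mulr1// => i /SB ->.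
  by rewrite (bigD1 i)//= (negbTE iB) mul0r mulr0.
have [->|[i iB]] := set_0Vmem B.
  by rewrite eqxx big1// => i _; rewrite inE subr0.
rewrite (bigD1 i)//= iB subrr mul0r; case: eqP => // B0.
by rewrite B0 inE in iB.
Qed.

Section AllHit.
Context (R : realType) (I : finType).
Implicit Types (V nu : {set I} -> R) (J K S B : {set I}).

(* For a random subset of I that misses each S with probability
   [expR (- V S)], inclusion-exclusion makes this the probability that it
   contains J. *)
Definition all_hit V J : R :=
  \sum_(S : {set I} | S \subset J) (-1) ^+ #|S| * expR (- V S).

(* [expR (- hitting_mass r nu S)] is the probability that S is missed by the
   union of the B's that occur in independent Poisson processes of rates
   [nu B]. *)
Definition hitting_mass (r : seq {set I}) nu S : R :=
  \sum_(B <- r | ~~ [disjoint B & S]) nu B.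

Lemma all_hit_nil nu J : all_hit (hitting_mass [::] nu) J = (J == finset.set0)%:R.
Proof.
rewrite -sum_sign_subset; apply: eq_bigr => S _.
by rewrite /hitting_mass big_nil oppr0 expR0 mulr1.
Qed.

(** Conditioning on whether [B] occurs: if it does, only [J :\: B] remains to be covered. In the
    sums, the sets [S] disjoint from [B] are those that lose no factor [expR (- nu B)]. *)
Lemma all_hit_cons B r nu J :
  all_hit (hitting_mass (B :: r) nu) J =
  expR (- nu B) * all_hit (hitting_mass r nu) J +
  (1 - expR (- nu B)) * all_hit (hitting_mass r nu) (J :\: B).
Proof.
rewrite /all_hit.
under [X in _ + _ * X]eq_bigl do rewrite finset.subsetD.
rewrite big_mkcondr/= !mulr_sumr -big_split/=; apply: eq_bigr => S _.
rewrite /hitting_mass big_cons disjoint_sym.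
case: (boolP [disjoint S & B]) => SB /=; first by ring.
by rewrite mulr0 addr0 opprD expRD; ring.
Qed.

Section Nonneg.
Context (nu : {set I} -> R) (nu_ge0 : forall B, 0 <= nu B).

Let q_bounds B : 0 <= expR (- nu B) <= 1.
Proof. by rewrite expR_ge0 expR_le1 oppr_le0 nu_ge0. Qed.

(** The sign is invisible in the alternating sum, but [all_hit_cons] is a convex combination and the
    recursion starts from an indicator. *)
Lemma all_hit_ge0 r J : 0 <= all_hit (hitting_mass r nu) J.
Proof.
elim: r J => [|B r IH] J; first by rewrite all_hit_nil.
rewrite all_hit_cons; have /andP[q0 q1] := q_bounds B.
by rewrite addr_ge0// mulr_ge0// subr_ge0.
Qed.

Lemma all_hit_anti r J K :
  J \subset K -> all_hit (hitting_mass r nu) K <= all_hit (hitting_mass r nu) J.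
Proof.
elim: r J K => [|B r IH] J K JK.
  rewrite !all_hit_nil; case: eqP => // K0.
  by move: JK; rewrite K0 finset.subset0 => ->.
rewrite !all_hit_cons; have /andP[q0 q1] := q_bounds B.
by rewrite lerD// ler_wpM2l ?subr_ge0// IH// finset.setSD.
Qed.

(* Chebyshev's sum inequality for the two-point law of "B occurs or not". *)
Lemma all_hitU r J K :
  all_hit (hitting_mass r nu) J * all_hit (hitting_mass r nu) K <=
  all_hit (hitting_mass r nu) (J :|: K).
Proof.
elim: r J K => [|B r IH] J K.
  rewrite !all_hit_nil finset.setU_eq0.
  by case: (J == _); case: (K == _); rewrite /= ?mulr0 ?mul0r ?mulr1.
rewrite !all_hit_cons finset.setDUl; have /andP[] := q_bounds B.
set q := expR _ => q0 q1.
have aa' := all_hit_anti r (finset.subsetDl J B).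
have bb' := all_hit_anti r (finset.subsetDl K B).
have ab_ge := IH J K; have ab'_ge := IH (J :\: B) (K :\: B).
set ab := all_hit _ (J :|: K) in ab_ge *.
set ab' := all_hit _ (_ :|: _) in ab'_ge *.
set a := all_hit _ J in aa' ab_ge *; set b := all_hit _ K in bb' ab_ge *.
set a' := all_hit _ (J :\: B) in aa' ab'_ge *.
set b' := all_hit _ (K :\: B) in bb' ab'_ge *.
(* This is the excess of [q * (a * b) + (1 - q) * (a' * b')] over the product of the averages of
   [a, a'] and of [b, b']. *)
have h1 : 0 <= q * (1 - q) * ((a' - a) * (b' - b)).
  by rewrite !mulr_ge0// subr_ge0.
have h2 : q * (a * b) <= q * ab by rewrite ler_wpM2l.
have h3 : (1 - q) * (a' * b') <= (1 - q) * ab' by rewrite ler_wpM2l// subr_ge0.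
lra.
Qed.

End Nonneg.
End AllHit.

(** * Limits of hitting functionals *)

Lemma cvg_scaled_1B_expRN (R : realType) (v : R) : 0 <= v ->
  n.+1%:R * (1 - expR (- (v / n.+1%:R))) @[n --> \oo] --> v.
Proof.
move=> v0.
(* For [y = v / n.+1%:R] the squeeze is [y - y ^+ 2 <= 1 - expR (- y) <= y], multiplied by
   [n.+1%:R]. *)
have lo : v - v ^+ 2 * harmonic n @[n --> \oo] --> v.
  rewrite -[X in _ --> X]subr0 -(mulr0 (v ^+ 2)).
  by apply: cvgB; [exact: cvg_cst|apply: cvgMr; exact: cvg_harmonic].
apply: (squeeze_cvgr _ lo (cvg_cst v)); near=> n.
set N : R := n.+1%:R; have N0 : 0 < N by rewrite ltr0n.
have vE : v = N * (v / N) by rewrite mulrC divfK// gt_eqF.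
have y0 : 0 <= v / N by rewrite divr_ge0// ltW.
have -> : v ^+ 2 * harmonic n = N * (v / N) ^+ 2.
  by rewrite /= -/N; move: N N0 {vE y0} => N N0; field; rewrite gt_eqF.
have -> : v - N * (v / N) ^+ 2 = N * (v / N - (v / N) ^+ 2) by rewrite mulrBr -vE.
rewrite [X in _ && (_ <= X)]vE !ler_pM2l//.
move: (v / N) y0 => y y0; apply/andP; split; last first.
  by have := expR_ge1Dx (- y); lra.
have : expR (- y) <= (1 + y)^-1.
  by rewrite expRN lef_pV2 ?posrE ?expR_gt0 ?expR_ge1Dx//; lra.
(* The product [(1 + y) * (1 - y + y ^+ 2)] equals [1 + y ^+ 3]. *)
suff : (1 + y)^-1 <= 1 - y + y ^+ 2 by lra.
rewrite -[leLHS]mul1r ler_pdivrMr; last lra.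
have : 0 <= y ^+ 3 by exact: exprn_ge0.
by rewrite !exprS expr0; nra.
Unshelve. all: by end_near. Qed.

Section Limit.
Context (R : realType) (I : finType) (V : {set I} -> R).
Context (nu : nat -> {set I} -> R).
Hypothesis V_ge0 : forall S, 0 <= V S.
Hypothesis nu_ge0 : forall n B, 0 <= nu n B.
Hypothesis nuE : forall n S,
  n.+1%:R * (1 - expR (- (V S / n.+1%:R))) = hitting_mass (index_enum _) (nu n) S.

Let V_cvg S : hitting_mass (index_enum _) (nu n) S @[n --> \oo] --> V S.
Proof.
under eq_cvg do rewrite -nuE.
exact: cvg_scaled_1B_expRN.
Qed.

Let all_hit_cvg J :
  all_hit (hitting_mass (index_enum _) (nu n)) J @[n --> \oo] --> all_hit V J.
Proof.
rewrite /all_hit; apply: cvg_big => [x|S _]; first exact: add_continuous.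
apply: cvgMr; apply: continuous_cvg; first exact: continuous_expR.
by apply: cvgN; exact: V_cvg.
Qed.

(** Nonnegativity and [all_hitU] survive the limit; they are then applied to the full set as a union
    of singletons, starting from the empty set. *)
Lemma prod_all_hit_le : \prod_i all_hit V [set i]%SET <= all_hit V [set: I]%SET.
Proof.
have h0 J : 0 <= all_hit V J.
  by apply: (cvgr_to_ge (@all_hit_cvg J)); near=> n; exact: all_hit_ge0.
have hU J K : all_hit V J * all_hit V K <= all_hit V (J :|: K).
  apply: (ler_cvg_to (cvgM (@all_hit_cvg J) (@all_hit_cvg K)) (@all_hit_cvg _)).
  by near=> n; exact: all_hitU.
have h1 : 1 <= all_hit V finset.set0.
  apply: (cvgr_to_ge (@all_hit_cvg _)); near=> n.
  rewrite /all_hit (big_pred1 finset.set0) => [|S]; last by rewrite finset.subset0.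
  rewrite cards0 expr0 mul1r /hitting_mass big_pred0 ?oppr0 ?expR0// => B.
  by rewrite disjoint_sym finset.disjoints_subset finset.sub0set.
have -> : [set: I]%SET = (\bigcup_i [set i])%SET.
  by apply/setP => i; rewrite inE; apply/esym/finset.bigcupP; exists i; rewrite ?inE.
elim/big_rec2: _ => [//|i J y _ IH].
by apply: le_trans (hU _ _); rewrite ler_wpM2l.
Unshelve. all: by end_near. Qed.

(** Before the limit, a set [B] counted on the left contains some [i], so its mass is counted at
    least once on the right. *)
Lemma mass_setT_le : V [set: I]%SET <= \sum_i V [set i]%SET.
Proof.
have sV : (\sum_i hitting_mass (index_enum _) (nu n) [set i]%SET) @[n --> \oo] -->
    \sum_i V [set i]%SET.
  by apply: cvg_big => [x|i _]; [exact: add_continuous|exact: V_cvg].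
apply: (ler_cvg_to (@V_cvg _) sV); near=> n.
rewrite /hitting_mass; under [leRHS]eq_bigr do rewrite big_mkcond.
rewrite [leRHS]exchange_big/= [leLHS]big_mkcond; apply: ler_sum => B _.
have t0 i : 0 <= if ~~ [disjoint B & [set i]%SET] then nu n B else 0.
  by case: ifP.
case: ifPn => [|_]; last exact: sumr_ge0.
rewrite finset.disjoints_subset finset.setCT finset.subset0 => /set0Pn[i iB].
rewrite (bigD1 i)//= ifT ?lerDl ?sumr_ge0//.
by rewrite disjoint_sym finset.disjoints1 iB.
Unshelve. all: by end_near. Qed.

End Limit.

(** * Finite families of events *)

Section RealProbability.
Context (disp : measure_display) (T : measurableType disp) (R : realType)
        (P : probability T R).

Lemma prob_fin_num (A : set T) : measurable A -> P A \is a fin_num.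
Proof. exact: fin_num_measure. Qed.

Lemma prob_le (A B : set T) : measurable A -> measurable B -> A `<=` B ->
  fine (P A) <= fine (P B).
Proof.
by move=> mA mB AB; rewrite fine_le ?prob_fin_num// le_measure// inE.
Qed.

Lemma prob_le1 (A : set T) : measurable A -> fine (P A) <= 1.
Proof.
by move=> mA; rewrite -lee_fin fineK ?prob_fin_num// probability_le1.
Qed.

Lemma probC (A : set T) : measurable A -> fine (P (~` A)) = 1 - fine (P A).
Proof.
by move=> mA; rewrite probability_setC// fineB ?prob_fin_num.
Qed.

Lemma probD (A B : set T) : measurable A -> measurable B ->
  fine (P (A `\` B)) = fine (P A) - fine (P (A `&` B)).
Proof.
move=> mA mB; have mAB : measurable (A `&` B) by exact: measurableI.
by rewrite measureD// ?fineB ?prob_fin_num// ltey_eq prob_fin_num.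
Qed.

(** The part of [A] outside [B] lies in the complement of [G]; the lemma serves for events [G] of
    full or nearly full probability. *)
Lemma prob_le_except (A B G : set T) :
  measurable A -> measurable B -> measurable G -> A `&` G `<=` B ->
  fine (P A) <= fine (P B) + (1 - fine (P G)).
Proof.
move=> mA mB mG AGB; have mGC : measurable (~` G) by exact: measurableC.
have mBG : measurable (B `|` ~` G) by exact: measurableU.
rewrite -probC// -fineD ?prob_fin_num//.
apply: (@le_trans _ _ (fine (P (B `|` ~` G)))).
  apply: prob_le => // w Aw; have [Gw|] := pselect (G w); last by right.
  by left; exact: AGB.
rewrite fine_le ?prob_fin_num// ?fin_numD ?prob_fin_num//.
exact: measureU2.
Qed.

Lemma measurable_forall_in (I : finType) (Q : pred I) (A : I -> set T) :
  (forall i, measurable (A i)) -> measurable [set w | forall i, Q i -> A i w].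
Proof.
by move=> mA; apply: (@fin_bigcap_measurable _ _ _ [set i | Q i]).
Qed.

Lemma measurable_forall (I : finType) (A : I -> set T) :
  (forall i, measurable (A i)) -> measurable [set w | forall i, A i w].
Proof.
move=> mA; rewrite (_ : [set _ | _] = [set w | forall i, predT i -> A i w]).
  exact: measurable_forall_in.
by apply/seteqP; split=> w /= Aw i //; exact: Aw.
Qed.

Section Pattern.
Context (I : finType) (A : I -> set T) (mA : forall i, measurable (A i)).
Implicit Types S B J : {set I}.

Definition pattern w : {set I} := [set i | `[< A i w >]]%SET.

Definition pattern_mass B : R := fine (P [set w | pattern w = B]).

Let measurable_pattern B : measurable [set w | pattern w = B].
Proof.
rewrite (_ : [set _ | _] =
    [set w | forall i, i \in B -> A i w] `&`
    [set w | forall i, i \notin B -> (~` A i) w]).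
  apply: measurableI; apply: measurable_forall_in => // i.
  exact: measurableC.
apply/seteqP; split => w /=.
  by move=> <-; split => i; rewrite inE => /asboolP.
case=> AB nAB; apply/setP => i; rewrite inE.
by apply/asboolP/idP => [Ai|/AB//]; apply/negPn/negP => /nAB.
Qed.

Lemma pattern_mass_ge0 B : 0 <= pattern_mass B.
Proof. exact: fine_ge0. Qed.

(** The classes of equal pattern partition the space, so probabilities of Boolean combinations of
    the [A i] become finite sums of nonnegative masses. *)
Lemma prob_pattern (E : pred {set I}) :
  fine (P [set w | E (pattern w)]) = \sum_(B : {set I} | E B) pattern_mass B.
Proof.
have -> : [set w | E (pattern w)] =
    \bigcup_(B in [set` E]) [set w | pattern w = B].
  apply/seteqP; split => w /=; first by move=> Ew; exists (pattern w).
  by case=> B /= EB ->.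
rewrite measure_fin_bigcup//; last by move=> B B' _ _ [w [/= <- <-]].
rewrite -(bigfs _ (r := index_enum _)) ?index_enum_uniq//; last first.
  by move=> B _; rewrite mem_index_enum.
rewrite (eq_bigr (fun B => (pattern_mass B)%:E)) ?sumEFin// => B _.
by rewrite /pattern_mass fineK// prob_fin_num.
Qed.

Lemma prob_all S :
  fine (P [set w | forall i, i \in S -> A i w]) =
  \sum_(B : {set I} | S \subset B) pattern_mass B.
Proof.
rewrite -prob_pattern; congr (fine (P _)); apply/seteqP; split=> w /=.
  by move=> Aw; apply/fintype.subsetP => i /Aw Ai; rewrite inE; apply/asboolP.
by move=> /fintype.subsetP + i iS => /(_ i iS); rewrite inE => /asboolP.
Qed.

Lemma prob_none S :
  fine (P [set w | forall i, i \in S -> ~ A i w]) =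
  \sum_(B : {set I} | [disjoint B & S]) pattern_mass B.
Proof.
rewrite -prob_pattern; congr (fine (P _)); apply/seteqP; split=> w /=.
  move=> Aw; rewrite disjoint_sym finset.disjoints_subset.
  apply/fintype.subsetP => i /Aw Ai.
  by rewrite !inE; apply/negP => /asboolP.
rewrite disjoint_sym finset.disjoints_subset.
by move=> /fintype.subsetP + i iS Ai => /(_ i iS); rewrite !inE => /asboolP.
Qed.

Lemma sum_pattern_mass : \sum_B pattern_mass B = 1.
Proof.
rewrite -(prob_pattern predT) (_ : [set w | _] = setT) ?probability_setT//.
by apply/seteqP; split.
Qed.

Lemma prob_some S :
  1 - fine (P [set w | forall i, i \in S -> ~ A i w]) =
  \sum_(B : {set I} | ~~ [disjoint B & S]) pattern_mass B.
Proof.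
rewrite prob_none -sum_pattern_mass.
by rewrite (bigID (fun B : {set I} => [disjoint B & S]%B)) /= addrC addrK.
Qed.

(** After exchanging the sums, the mass of [B] is multiplied by the alternating sum over subsets of
    [J :&: B], which vanishes unless this set is empty. *)
Lemma prob_inclusion_exclusion J :
  fine (P [set w | forall i, i \in J -> ~ A i w]) =
  \sum_(S : {set I} | S \subset J) (-1) ^+ #|S| *
    fine (P [set w | forall i, i \in S -> A i w]).
Proof.
under eq_bigr do rewrite prob_all mulr_sumr big_mkcond.
rewrite exchange_big/= prob_none big_mkcond; apply: eq_bigr => B _.
rewrite -big_mkcondr/=.
rewrite (eq_bigl (fun S : {set I} => S \subset J :&: B)%SET) => [|S]; last first.
  by rewrite finset.subsetI.
rewrite -mulr_suml sum_sign_subset finset.setIC finset.setI_eq0.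
by case: ifP; rewrite ?mul1r ?mul0r.
Qed.

Lemma prob_union_bound S :
  1 - fine (P [set w | forall i, i \in S -> ~ A i w]) <=
  \sum_(i in S) fine (P (A i)).
Proof.
rewrite prob_some.
have PA i : fine (P (A i)) = \sum_(B : {set I} | i \in B) pattern_mass B.
  rewrite -prob_pattern; congr (fine (P _)); apply/seteqP; split=> w /=.
    by rewrite inE => /asboolP.
  by rewrite inE => /asboolP.
under [leRHS]eq_bigr do rewrite PA big_mkcond.
rewrite [leRHS]exchange_big/= [leLHS]big_mkcond; apply: ler_sum => B _.
have t0 i : 0 <= if i \in B then pattern_mass B else 0.
  by case: ifP => _; rewrite ?pattern_mass_ge0.
case: ifPn => [|_]; last exact: sumr_ge0.
rewrite finset.disjoints_subset => /fintype.subsetPn[i iB].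
rewrite inE negbK => iS; rewrite (bigD1 i)//= iB lerDl; exact: sumr_ge0.
Qed.

End Pattern.
End RealProbability.

(** * Unit Frechet vectors and block events *)

Section FrechetVector.
Context (disp : measure_display) (T : measurableType disp) (R : realType)
        (P : probability T R) (d : nat) (Z : 'I_d -> {RV P >-> R}).
Implicit Types (S : {set 'I_d}) (x : 'I_d -> R).

Lemma measurable_RV_le (Y : {RV P >-> R}) c : measurable [set w | Y w <= c].
Proof.
rewrite (_ : [set _ | _] = Y @^-1` `]-oo, c]).
  by rewrite -[X in measurable X]setTI; exact: measurable_funPT.
by apply/seteqP; split => w /=; rewrite in_itv.
Qed.

Lemma measurable_sub_event S x :
  measurable [set w | forall i, i \in S -> Z i w <= x i].
Proof. by apply: measurable_forall_in => i; exact: measurable_RV_le. Qed.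
Hint Resolve measurable_RV_le measurable_sub_event : core.

Lemma sub_cdf_fin_num S x : sub_cdf Z S x \is a fin_num.
Proof. exact: prob_fin_num. Qed.

Lemma sub_cdfT x : sub_cdf Z [set: 'I_d]%SET x = joint_cdf Z x.
Proof.
congr (P _); apply/seteqP; split => w /= Zx i; first by apply: Zx; rewrite inE.
by move=> _; exact: Zx.
Qed.

Lemma fine_sub_cdf_le1 S x : fine (sub_cdf Z S x) <= 1.
Proof. exact: prob_le1. Qed.

Lemma fine_sub_cdf_le S S' x x' : S' \subset S ->
  (forall i, i \in S' -> x i <= x' i) ->
  fine (sub_cdf Z S x) <= fine (sub_cdf Z S' x').
Proof.
move=> /fintype.subsetP S'S xx'; apply: prob_le => // w /= Zx i iS'.
exact: le_trans (Zx i (S'S _ iS')) (xx' i iS').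
Qed.

Hypothesis frechetZ : forall i, unit_frechet (Z i).

Lemma unit_frechet_cdf i c : fine (P [set w | Z i w <= c]) = frechet_cdf c.
Proof.
have /(congr1 fine) /= <- := frechetZ i c.
congr (fine (P _)); apply/seteqP; split => w /=; by rewrite in_itv.
Qed.

(** Union bound: each margin exceeds [m] with probability [1 - expR (- m^-1)], at most [m^-1]. *)
Lemma all_le_prob_ge (m : R) : 0 < m ->
  1 - fine (P [set w | forall i, Z i w <= m]) <= d%:R / m.
Proof.
move=> m0.
have mC i : measurable (~` [set w | Z i w <= m]) by exact: measurableC.
have := prob_union_bound P mC [set: 'I_d]%SET.
rewrite (_ : [set w | _] = [set w | forall i, Z i w <= m]); last first.
  apply/seteqP; split => w /= Zm i; last by move=> _; rewrite /setC/=; apply.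
  by apply: contrapT; apply: Zm; rewrite inE.
move=> /le_trans; apply.
rewrite (eq_bigl predT) => [|i]; last by rewrite inE.
apply: (@le_trans _ _ (\sum_(i < d) m^-1)); last first.
  by rewrite sumr_const card_ord mulr_natl.
apply: ler_sum => i _; rewrite probC// unit_frechet_cdf /frechet_cdf m0.
by have := expR_ge1Dx (- m^-1); lra.
Qed.

(** Max-stability speaks of the full vector at finite levels. Giving the coordinates outside [S] a
    large level [m] recovers the law of the subvector up to an error [d%:R / m]. *)
Definition pad S x (m : R) (i : 'I_d) : R := if i \in S then x i else m.

Lemma sub_cdf_pad_ge S S' x m : 0 < m ->
  fine (sub_cdf Z (S :&: S')%SET x) - d%:R / m <= fine (sub_cdf Z S' (pad S x m)).
Proof.
move=> m0; rewrite lerBlDr.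
have mG : measurable [set w | forall i, Z i w <= m].
  apply: (@measurable_forall _ _ _ (fun i => [set w | Z i w <= m])) => i.
  exact: measurable_RV_le.
apply: (le_trans (prob_le_except _ _ _ mG (B := [set w |
  forall i, i \in S' -> Z i w <= pad S x m i]) _)) => //.
  move=> w [/= Zx Zm] i iS'; rewrite /pad; case: ifPn => // iS.
  by apply: Zx; rewrite inE iS.
by rewrite lerD2l; exact: all_le_prob_ge.
Qed.

Lemma sub_cdf_pad_le S x m :
  fine (joint_cdf Z (pad S x m)) <= fine (sub_cdf Z S x).
Proof.
rewrite -sub_cdfT; apply: fine_sub_cdf_le => [|i iS]; first exact: finset.subsetT.
by rewrite /pad iS.
Qed.

(** The factor [t] in the padding level lets the padded vectors at [x] and at [t * x] be exact
    rescalings of each other. *)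
Lemma pad_cvg S x (t : R) : 0 < t ->
  fine (joint_cdf Z (pad S x (t * n.+1%:R))) @[n --> \oo] --> fine (sub_cdf Z S x).
Proof.
move=> t0.
have lo : fine (sub_cdf Z S x) - d%:R / t * harmonic n @[n --> \oo] -->
    fine (sub_cdf Z S x).
  rewrite -[X in _ --> X]subr0 -(mulr0 (d%:R / t)).
  by apply: cvgB; [exact: cvg_cst|apply: cvgMr; exact: cvg_harmonic].
apply: (squeeze_cvgr _ lo (cvg_cst _)); near=> n.
rewrite sub_cdf_pad_le andbT.
have tn0 : 0 < t * n.+1%:R by rewrite mulr_gt0.
have := @sub_cdf_pad_ge S [set: 'I_d]%SET x _ tn0.
by rewrite finset.setIT sub_cdfT invfM mulrA.
Unshelve. all: by end_near. Qed.

Hypothesis stableZ : max_stable Z.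

(** Scaling by [t] lifts every coordinate to at least [m = d.+1%:R], where the union bound leaves
    probability at least [1 - d%:R / m], which is positive; max-stability carries positivity back to
    [x]. *)
Lemma fine_joint_cdf_gt0 x : (forall i, 0 < x i) -> 0 < fine (joint_cdf Z x).
Proof.
move=> x0; pose m : R := d.+1%:R.
pose t : R := 1 + \sum_i m / x i.
have t1 : 1 <= t by rewrite lerDl sumr_ge0// => i _; rewrite divr_ge0// ltW.
have t0 : 0 < t by exact: lt_le_trans t1.
have mtx i : m <= t * x i.
  rewrite -ler_pdivrMr// /t (bigD1 i)//= addrCA lerDl addr_ge0//.
  by rewrite sumr_ge0// => j _; rewrite divr_ge0// ltW.
have : 0 < fine (joint_cdf Z (fun i => t * x i)).
  have m0 : 0 < m by rewrite ltr0n.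
  have := all_le_prob_ge m0; rewrite -/(joint_cdf Z (fun=> m)) => h.
  apply: (@lt_le_trans _ _ (fine (joint_cdf Z (fun=> m)))).
    apply: (@lt_le_trans _ _ (1 - d%:R / m)); last by rewrite lerBlDr -lerBlDl.
    by rewrite subr_gt0 ltr_pdivrMr// mul1r ltr_nat.
  by rewrite -!sub_cdfT; apply: fine_sub_cdf_le.
by move=> /(@powR_gt0 _ _ t); rewrite stableZ.
Qed.

Lemma fine_sub_cdf_gt0 S x : (forall i, 0 < x i) -> 0 < fine (sub_cdf Z S x).
Proof.
move=> x0; apply: lt_le_trans (fine_joint_cdf_gt0 x0) _.
by rewrite -sub_cdfT; apply: fine_sub_cdf_le => //; exact: finset.subsetT.
Qed.

(** Max-stability at the padded points passes to the limit, since the power is continuous at a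
    positive base. *)
Lemma sub_max_stable S (t : R) x : 0 < t -> (forall i, 0 < x i) ->
  fine (sub_cdf Z S (fun i => t * x i)) `^ t = fine (sub_cdf Z S x).
Proof.
move=> t0 x0.
have tx0 : 0 < fine (sub_cdf Z S (fun i => t * x i)).
  by apply: fine_sub_cdf_gt0 => i; rewrite mulr_gt0.
have cpow : {for fine (sub_cdf Z S (fun i => t * x i)),
    continuous (fun a : R => a `^ t)}.
  apply: differentiable_continuous; apply/derivable1_diffP.
  by apply: derivable_powR; rewrite in_itv/= tx0.
have h1 : fine (joint_cdf Z (pad S (fun i => t * x i) (t * n.+1%:R))) `^ t
    @[n --> \oo] --> fine (sub_cdf Z S (fun i => t * x i)) `^ t.
  exact: (cvg_comp _ (fun a : R => a `^ t) (@pad_cvg S (fun i => t * x i) _ t0) cpow).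
have h2 := @pad_cvg S x _ (@ltr01 R).
suff E : (fun n => fine (joint_cdf Z (pad S (fun i => t * x i) (t * n.+1%:R))) `^ t)
    = (fun n => fine (joint_cdf Z (pad S x (1 * n.+1%:R)))).
  by move: h1; rewrite E => h1; exact: (cvg_unique (@Rhausdorff R) h1 h2).
apply/funext => n /=; rewrite mul1r -(@stableZ t (pad S x n.+1%:R)) //; last first.
  by move=> i; rewrite /pad; case: ifP.
congr (fine (joint_cdf Z _) `^ t); apply/funext => i.
by rewrite /pad; case: ifP.
Qed.

Lemma ln_sub_cdf_scale S (t : R) x : 0 < t -> (forall i, 0 < x i) ->
  fine (sub_cdf Z S (fun i => t * x i)) = expR (ln (fine (sub_cdf Z S x)) / t).
Proof.
move=> t0 x0; rewrite -(sub_max_stable S t0 x0) ln_powR mulrAC divff ?gt_eqF//.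
by rewrite mul1r lnK// posrE fine_sub_cdf_gt0// => i; rewrite mulr_gt0.
Qed.

Lemma extremal_coef_ge0 S : 0 <= extremal_coef Z S.
Proof. by rewrite oppr_ge0 ln_le0// fine_sub_cdf_le1. Qed.

Lemma sub_cdf_cst S (c : R) : 0 < c ->
  fine (sub_cdf Z S (fun=> c)) = expR (- (extremal_coef Z S / c)).
Proof.
move=> c0; have := @ln_sub_cdf_scale S c (fun=> 1) c0 (fun=> ltr01).
by rewrite mulr1 => ->; rewrite /extremal_coef mulNr opprK.
Qed.

End FrechetVector.

(** * Positive dependence of block events under max-stability *)

Section BlockDependence.
Context (disp : measure_display) (T : measurableType disp) (R : realType)
        (P : probability T R) (d p : nat) (Z : 'I_d -> {RV P >-> R}).
Context (I : 'I_p -> {set 'I_d}).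

Definition block_event (c : 'I_p -> R) j : set T :=
  [set w | forall i, i \in I j -> Z i w <= c j].

Lemma measurable_block_event c j : measurable (block_event c j).
Proof. exact: (@measurable_sub_event _ _ _ _ _ _ _ (fun=> c j)). Qed.
Hint Resolve measurable_block_event : core.

Lemma measurable_block_eventC c j : measurable (~` block_event c j).
Proof. exact: measurableC. Qed.
Hint Resolve measurable_block_eventC : core.

Lemma joint_block_event (S : {set 'I_p}) c (x : 'I_d -> R) :
  (forall j i, i \in I j -> x i = c j) ->
  P [set w | forall j, j \in S -> block_event c j w] =
  sub_cdf Z (\bigcup_(j in S) I j)%SET x.
Proof.
move=> xE; congr (P _); apply/seteqP; split => w /= Zw.
  by move=> i /finset.bigcupP[j jS ij]; rewrite (xE j)//; exact: Zw.
move=> j jS i ij; rewrite -(xE j i ij); apply: Zw.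
by apply/finset.bigcupP; exists j.
Qed.

Lemma block_event_sub_cdf c (x : 'I_d -> R) j :
  (forall i, i \in I j -> x i = c j) -> P (block_event c j) = sub_cdf Z (I j) x.
Proof.
by move=> xE; congr (P _); apply/seteqP; split => w /= Zw i ij; move: (Zw i ij);
  rewrite xE.
Qed.

(** One vector of levels constant on each block; the default 1 keeps the levels positive outside the
    blocks. *)
Definition block_level (c : 'I_p -> R) i : R :=
  if [pick j | i \in I j] is Some j then c j else 1.

Hypothesis disjI : forall j k, j != k -> (I j :&: I k)%SET = finset.set0.

Lemma block_levelE c j i : i \in I j -> block_level c i = c j.
Proof.
rewrite /block_level => ij; case: pickP => [k ik|/(_ j)]; last by rewrite ij.
have [->//|/disjI /setP /(_ i)] := eqVneq k j.
by rewrite !inE ij ik.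
Qed.

Hypothesis mevZ : unit_frechet_MEV Z.
Context (c : 'I_p -> R) (c_gt0 : forall j, 0 < c j).

Let x := block_level c.

Let x_gt0 i : 0 < x i.
Proof. by rewrite /x /block_level; case: pickP. Qed.

Let xE j i : i \in I j -> x i = c j.
Proof. exact: block_levelE. Qed.

Let joint (t : R) (S : {set 'I_p}) : R :=
  fine (P [set w | forall j, j \in S -> block_event (fun k => t * c k) j w]).

Let jointE t S :
  joint t S = fine (sub_cdf Z (\bigcup_(j in S) I j)%SET (fun i => t * x i)).
Proof. by rewrite -(@joint_block_event _ (fun k => t * c k))// => j i /xE ->. Qed.

Let V S := - ln (joint 1 S).

Let joint_scale t S : 0 < t -> joint t S = expR (- (V S / t)).
Proof.
move=> t0; rewrite /V mulNr opprK !jointE (ln_sub_cdf_scale _ _ _ t0)//; last by case: mevZ.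
  rewrite (_ : (fun i => 1 * x i) = x)//.
  by apply/funext => i; rewrite mul1r.
by case: mevZ.
Qed.

Let expRV S : expR (- V S) = joint 1 S.
Proof. by rewrite (joint_scale _ ltr01) divr1. Qed.

Let V_ge0 S : 0 <= V S.
Proof.
rewrite oppr_ge0 ln_le0// prob_le1//.
exact: measurable_forall_in.
Qed.

(** The events are complements, so the pattern is the set of blocks exceeding the raised levels. *)
Let nu n B : R :=
  n.+1%:R * pattern_mass P (fun j => ~` block_event (fun k => n.+1%:R * c k) j) B.

Let nu_ge0 n B : 0 <= nu n B.
Proof. by rewrite mulr_ge0// pattern_mass_ge0. Qed.

(** By [joint_scale] with [t = n.+1%:R], the difference [1 - expR (- (V S / n.+1%:R))] is the
    probability that some block of [S] exceeds its raised level. *)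
Let nuE n S :
  n.+1%:R * (1 - expR (- (V S / n.+1%:R))) = hitting_mass (index_enum _) (nu n) S.
Proof.
rewrite -joint_scale// /hitting_mass -mulr_sumr -prob_some//.
congr (_ * (1 - fine (P _))); apply/seteqP; split => w /= Zw j jS.
  by move=> nZ; apply: nZ; exact: Zw.
by have /contrapT := Zw j jS.
Qed.

Let joint1E S : joint 1 S = fine (P [set w | forall j, j \in S -> block_event c j w]).
Proof.
rewrite /joint (_ : (fun k => 1 * c k) = c)//.
by apply/funext => k; rewrite mul1r.
Qed.

Let joint1_set1 j : joint 1 [set j]%SET = fine (P (block_event c j)).
Proof.
rewrite joint1E; congr (fine (P _)); apply/seteqP; split => w /=.
  by apply; rewrite inE.
by move=> Zw k; rewrite inE => /eqP ->.
Qed.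

Let all_hitE J :
  all_hit V J = fine (P [set w | forall j, j \in J -> ~ block_event c j w]).
Proof.
rewrite prob_inclusion_exclusion//; apply: eq_bigr => S _.
by rewrite expRV joint1E.
Qed.

(** In logarithms this is the subadditivity of [V] given by [mass_setT_le]. *)
Lemma prob_block_event_le :
  \prod_j fine (P (block_event c j)) <= fine (P [set w | forall j, block_event c j w]).
Proof.
under eq_bigr do rewrite -joint1_set1 -expRV.
rewrite (_ : [set w | _] = [set w | forall j, j \in [set: 'I_p]%SET -> block_event c j w]).
  rewrite -joint1E -expRV -expR_sum ler_expR sumrN lerN2.
  exact: mass_setT_le V_ge0 nu_ge0 nuE.
apply/seteqP; split => w /= Zw j => [_|]; first exact: Zw.
by apply: Zw; rewrite inE.
Qed.

(** By inclusion-exclusion [all_hit V J] is the probability that all blocks of [J] exceed their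
    levels, so [prod_all_hit_le] applies. *)
Lemma prob_block_eventC_le :
  \prod_j fine (P (~` block_event c j)) <=
  fine (P [set w | forall j, ~ block_event c j w]).
Proof.
have -> : [set w | forall j, ~ block_event c j w] =
    [set w | forall j, j \in [set: 'I_p]%SET -> ~ block_event c j w].
  apply/seteqP; split => w /= Zw j => [_|]; first exact: Zw.
  by apply: Zw; rewrite inE.
have E j : fine (P (~` block_event c j)) = all_hit V [set j]%SET.
  rewrite all_hitE; congr (fine (P _)); apply/seteqP; split => w /=.
    by move=> Zw k; rewrite inE => /eqP ->.
  by apply; rewrite inE.
under eq_bigr do rewrite E.
rewrite -all_hitE; exact: prod_all_hit_le V_ge0 nu_ge0 nuE.
Qed.

End BlockDependence.

(** * The max-min coefficient as an integral over levels *)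

Section Gap.
Local Open Scope ereal_scope.
Context (disp : measure_display) (T : measurableType disp) (R : realType)
        (P : probability T R).
Context (m M : T -> R).
Hypothesis mm : measurable_fun setT m.
Hypothesis mM : measurable_fun setT M.

Let GR := measurableTypeR R.

Let gap : set (T * GR) := [set z | (m z.1 <= z.2 < M z.1)%R].

Let measurable_gap : measurable gap.
Proof.
have m1 : measurable_fun setT (fun z : T * GR => m z.1 <= z.2)%R.
  by apply: measurable_fun_ler; [exact: measurableT_comp|exact: measurable_snd].
have m2 : measurable_fun setT (fun z : T * GR => z.2 < M z.1)%R.
  by apply: measurable_fun_ltr; [exact: measurable_snd|exact: measurableT_comp].
have := measurable_and m1 m2 => /(_ measurableT [set true]).
by rewrite setTI; apply.
Qed.

Let measurable_indic_gap :
  measurable_fun setT (fun z : T * GR => (\1_gap z : R)%:E).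
Proof. exact/measurable_EFinP/measurable_indic. Qed.

Let section_gap u : \int[P]_w (\1_gap (w, u) : R)%:E = P [set w | (m w <= u < M w)%R].
Proof.
rewrite -[X in _ = P X]setIT -integral_indic//.
have := measurable_ysection u measurable_gap.
by rewrite ysectionE.
Qed.

Lemma measurable_prob_gap :
  measurable_fun [set: R] (fun u => P [set w | (m w <= u < M w)%R]).
Proof.
rewrite (_ : (fun u => _) = (fun u => \int[P]_w (\1_gap (w, u) : R)%:E)).
  by apply: (measurable_fun_fubini_tonelli_G _ measurable_indic_gap) => z; rewrite lee_fin.
by apply/funext => u; rewrite section_gap.
Qed.

(* Layer cake: [M - m] is the length of the set of levels u between m and M. *)
Lemma expectation_gap :
  (forall w, 0 <= m w <= M w)%R -> (forall w, M w <= 1)%R ->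
  'E_P[(fun w => M w - m w)%R] =
  \int[@lebesgue_measure R]_(u in `]0%R, 1%R[) P [set w | (m w <= u < M w)%R].
Proof.
move=> m0M M1; rewrite unlock.
transitivity (\int[P]_w \int[@lebesgue_measure R]_u (\1_gap (w, u) : R)%:E).
  apply: eq_integral => w _.
  have /andP[_ mMw] := m0M w.
  rewrite -[RHS]/(\int[@lebesgue_measure R]_u (\1_`[m w, M w[%classic u)%:E).
  rewrite integral_indic// setIT; rewrite [RHS]lebesgue_measure_itv/= lte_fin.
  move: mMw; rewrite le_eqVlt => /predU1P[->|->]; last by rewrite EFinB.
  by rewrite ltxx subrr.
rewrite (fubini_tonelli _ measurable_indic_gap); last first.
  by move=> z; rewrite lee_fin.
under eq_integral do rewrite section_gap.
(* The bounds on [m] and [M] confine [u] to [[0, 1[]; the endpoint 0 is added back before extending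
   the integral to the line. *)
rewrite -(@integral_itv_bndoo R 0%R 1%R _ true true); last first.
  exact: measurable_funTS measurable_prob_gap.
rewrite [RHS]integral_mkcond; apply: eq_integral => u _.
rewrite patchE; case: ifPn => //; rewrite notin_setE/= in_itv/= => u01.
rewrite (_ : [set _ | _] = set0) ?measure0//.
apply/seteqP; split => w //= /andP[mu uM]; apply: u01.
have /andP[m0 _] := m0M w.
by rewrite (le_trans m0 mu) (lt_le_trans uM).
Qed.

End Gap.

Lemma measurable_fun_big (disp : measure_display) (T : measurableType disp)
    (R : realType) (op : R -> R -> R) (x0 : R) (I : Type) (r : seq I)
    (Q : pred I) (F : I -> T -> R) :
  (forall f g : T -> R, measurable_fun setT f -> measurable_fun setT g ->
    measurable_fun setT (fun w => op (f w) (g w))) ->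
  (forall i, measurable_fun setT (F i)) ->
  measurable_fun setT (fun w => \big[op/x0]_(i <- r | Q i) F i w).
Proof.
move=> mop mF; elim: r => [|i r IH].
  rewrite (_ : (fun w => _) = cst x0); first exact: measurable_cst.
  by apply/funext => w; rewrite big_nil.
rewrite (_ : (fun w => _) = if Q i
    then (fun w => op (F i w) (\big[op/x0]_(k <- r | Q k) F k w))
    else (fun w => \big[op/x0]_(k <- r | Q k) F k w)); last first.
  by apply/funext => w; rewrite big_cons; case: ifP.
by case: ifP => // _; exact: mop.
Qed.

Lemma frechet_cdf_nondecreasing (R : realType) :
  {homo @frechet_cdf R : x y / x <= y}.
Proof.
move=> x y xy; rewrite /frechet_cdf; case: ifPn => x0; last first.
  by case: ifP => // _; exact: expR_ge0.
have y0 := lt_le_trans x0 xy.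
by rewrite y0 ler_expR lerN2 lef_pV2.
Qed.

Lemma frechet_cdf_powR_le (R : realType) (y lam u : R) :
  0 < lam -> 0 < u < 1 ->
  (frechet_cdf y `^ lam <= u) = (y <= lam / - ln u).
Proof.
move=> lam0 /andP[u0 u1].
have lnu : 0 < - ln u by rewrite oppr_gt0 ln_lt0// u0.
(* For [y <= 0] both sides hold: the power is 0 and the bound on the right is nonnegative. *)
rewrite /frechet_cdf; case: ltP => y0; last first.
  rewrite powR0 ?gt_eqF// ltW//; apply/esym/(le_trans y0).
  by rewrite divr_ge0// ltW.
rewrite -expRM -[u in LHS]lnK ?posrE// ler_expR ler_pdivlMr//.
by rewrite mulNr lerNl mulrC ler_pdivlMr// mulrC.
Qed.

Section BlockMargin.
Context (disp : measure_display) (T : measurableType disp) (R : realType)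
        (P : probability T R) (d p : nat) (Z : 'I_d -> {RV P >-> R}).
Context (I : 'I_p -> {set 'I_d}) (lambda : 'I_p -> R).
Hypothesis lambda_gt0 : forall j, 0 < lambda j.

Let level u j := lambda j / - ln u.

Lemma block_margin_le j w u : 0 < u < 1 ->
  (block_margin I Z lambda j w <= u) <-> block_event Z I (level u) j w.
Proof.
move=> u01; rewrite frechet_cdf_powR_le// /block_event/=.
(* The maximum over the block starts at 0, which must not exceed the level. *)
have lev0 : 0 <= level u j.
  case/andP: u01 => u0 u1; rewrite divr_ge0 ?oppr_ge0 ?ln_le0//; exact: ltW.
split=> [/bigmax_leP[_ +] i ij|Zj]; first exact.
by apply/bigmax_leP; split => // i ij; exact: Zj.
Qed.

Lemma measurable_block_margin j : measurable_fun setT (block_margin I Z lambda j).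
Proof.
apply: (@measurableT_comp _ _ _ _ _ _ (@powR R ^~ (lambda j))).
  exact: measurable_powR.
apply: (@measurableT_comp _ _ _ _ _ _ (@frechet_cdf R)).
  by apply: nondecreasing_measurable => //; exact: frechet_cdf_nondecreasing.
apply: measurable_fun_big => [f g mf mg|i]; first exact: measurable_maxr.
exact: measurable_funPT.
Qed.

Lemma block_margin_bounds j w : 0 <= block_margin I Z lambda j w <= 1.
Proof.
rewrite powR_ge0/= (_ : 1 = 1 `^ lambda j); last by rewrite powR1.
apply: ge0_ler_powR; rewrite ?nnegrE//; first exact: ltW.
  by rewrite /frechet_cdf; case: ifP => // _; exact: expR_ge0.
rewrite /frechet_cdf; case: ifP => // y0.
by rewrite expR_le1 oppr_le0 invr_ge0 ltW.
Qed.

Definition mixed_event u : set T :=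
  [set w | (exists j, block_event Z I (level u) j w) /\
           (exists j, ~ block_event Z I (level u) j w)].

Local Notation mn := (fun w => \big[Num.min/1]_(j < p) block_margin I Z lambda j w).
Local Notation mx := (fun w => \big[Num.max/0]_(j < p) block_margin I Z lambda j w).

Lemma mixed_eventE u : 0 < u < 1 -> mixed_event u = [set w | mn w <= u < mx w].
Proof.
move=> u01; case/andP: (u01) => u0 u1; apply/seteqP; split => w /=.
  case=> -[j Zj] [k Zk]; apply/andP; split.
    by apply/bigmin_leP; right; exists j => //; apply/block_margin_le.
  apply/bigmax_gtP; right; exists k => //; rewrite ltNge; apply/negP.
  by move/block_margin_le => /(_ u01).
(* The defaults 1 and 0 cannot be what satisfies the bounds, as [u] lies strictly between 0 and
   1. *)
case/andP => /bigmin_leP[|[j _ Zj]]; first by rewrite leNgt u1.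
case/bigmax_gtP => [|[k _ Zk]]; first by rewrite ltNge ltW.
split; first by exists j; apply/block_margin_le.
exists k => /block_margin_le => /(_ u01); by rewrite leNgt Zk.
Qed.

(** Some block must exist for the minimum to lie below the maximum: the bare defaults 1 and 0 are in
    the wrong order. Measurability in [u] is provided for comparing such integrals. *)
Lemma max_min_coefE : (0 < p)%N ->
  max_min_coef I Z lambda =
  (\int[@lebesgue_measure R]_(u in `]0%R, 1%R[) P (mixed_event u))%E /\
  measurable_fun (`]0%R, 1%R[%classic : set R) (fun u => P (mixed_event u)).
Proof.
move=> p0; have mmn : measurable_fun setT mn.
  by apply: measurable_fun_big => [f g mf mg|j];
    [exact: measurable_minr|exact: measurable_block_margin].
have mmx : measurable_fun setT mx.
  by apply: measurable_fun_big => [f g mf mg|j];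
    [exact: measurable_maxr|exact: measurable_block_margin].
have eqP01 : {in (`]0%R, 1%R[%classic : set R), forall u,
    P (mixed_event u) = P [set w | mn w <= u < mx w]}.
  by move=> u; rewrite inE/= in_itv/= => u01; rewrite mixed_eventE.
split; last first.
  apply: (eq_measurable_fun (fun u => P [set w | mn w <= u < mx w])).
    by move=> u /eqP01 ->.
  by apply: measurable_funTS; exact: measurable_prob_gap.
transitivity (\int[@lebesgue_measure R]_(u in `]0%R, 1%R[)
    P [set w | (mn w <= u < mx w)%R])%E; last by apply: eq_integral => u /eqP01.
apply: expectation_gap => // w.
  apply/andP; split.
    by apply/bigmin_geP; split => // j _; have /andP[] := block_margin_bounds j w.
  apply: (@le_trans _ _ (block_margin I Z lambda (Ordinal p0) w)).
    exact: bigmin_le.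
  exact: le_bigmax.
by apply/bigmax_leP; split => // j _; have /andP[] := block_margin_bounds j w.
Qed.

End BlockMargin.

(** * Integrals of powers over the unit interval *)

Section IntegralPowR.
Context (R : realType).

(** This serves both for the integrand and for its primitive; at 0 only one-sided continuity is
    claimed, since a power with [e < 1] has no derivative there. *)
Lemma derivable_oo_LRcontinuous_powR (a e : R) : 0 < e ->
  derivable_oo_LRcontinuous (fun u : R => a * u `^ e) 0 1.
Proof.
move=> e0; have dpow (u : R) : 0 < u -> derivable (fun u : R => a * u `^ e) u 1.
  by move=> u0; apply: derivableM => //; apply: derivable_powR; rewrite in_itv/= u0.
split.
- by move=> u; rewrite in_itv/= => /andP[u0 _]; exact: dpow.
- by rewrite powR0 ?gt_eqF//; apply: cvgMr; exact: powR_cvg0.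
- have /derivable1_diffP/differentiable_continuous c1 := dpow 1 ltr01.
  exact: (cvg_at_left_filter c1).
Qed.

Lemma integral_powR (e : R) : 0 <= e ->
  (\int[@lebesgue_measure R]_(u in `]0%R, 1%R[) (u `^ e)%:E = ((1 + e)^-1)%:E)%E.
Proof.
move=> e0; rewrite -(@integral_itv_bndoo R 0%R 1%R _ true false); last first.
  by apply/measurable_EFinP; apply: measurable_funTS; exact: measurable_powR.
(* The exponent 0 is set apart because continuity at 0 is available only for positive exponents. *)
have [<-|e_neq0] := eqVneq 0 e.
  under eq_integral do rewrite powRr0.
  by rewrite integral_cst// mul1e [LHS]lebesgue_measure_itv/= lte_fin ltr01 oppr0 adde0 addr0 invr1.
have e_gt0 : 0 < e by rewrite lt_neqAle e_neq0.
have e1_gt0 : 0 < 1 + e by rewrite addr_gt0.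
have cf := derivable_oo_LRcontinuous_within (derivable_oo_LRcontinuous_powR 1 e_gt0).
have dF := derivable_oo_LRcontinuous_powR (1 + e)^-1 e1_gt0.
transitivity (\int[@lebesgue_measure R]_(u in `[0%R, 1%R]) (1 * u `^ e)%:E)%E.
  by apply: eq_integral => u _; rewrite mul1r.
rewrite (continuous_FTC2 ltr01 cf dF).
  by rewrite powR1 mulr1 powR0 ?gt_eqF// mulr0 sube0.
move=> u; rewrite in_itv/= => /andP[u0 _].
rewrite derive1E deriveZ//=; last by apply: derivable_powR; rewrite in_itv/= u0.
have -> : 'D_1 (fun u : R => u `^ (1 + e)) u = (1 + e) * u `^ (1 + e - 1).
  by apply: derive_val; exact: is_derive1_powR.
rewrite /GRing.scale/= mulrA mulVf ?gt_eqF//.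
by rewrite addrAC subrr add0r.
Qed.

Lemma integral_sum_powR (K : finType) (Q : pred K) (a e : K -> R) :
  (forall k, 0 <= e k) ->
  (\int[@lebesgue_measure R]_(u in `]0%R, 1%R[)
     (\sum_(k | Q k) a k * u `^ e k)%:E =
   (\sum_(k | Q k) a k / (1 + e k))%:E)%E.
Proof.
move=> e0.
have ipow k : (@lebesgue_measure R).-integrable `]0%R, 1%R[
    (fun u => (u `^ e k)%:E).
  apply/integrableP; split.
    by apply/measurable_EFinP; apply: measurable_funTS; exact: measurable_powR.
  under eq_integral do rewrite gee0_abs ?lee_fin ?powR_ge0//.
  by rewrite integral_powR// ltry.
under eq_integral do rewrite -sumEFin.
rewrite integral_sum//; last first.
  by move=> k; exact: (integrableZl _ (a k) (ipow k)).
rewrite -sumEFin; apply: eq_bigr => k _.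
under eq_integral do rewrite EFinM.
by rewrite integralZl// integral_powR.
Qed.

End IntegralPowR.

(** * Independent and totally dependent blocks *)

Section MixedProbability.
Context (disp : measure_display) (T : measurableType disp) (R : realType)
        (P : probability T R) (p : nat) (A : 'I_p -> set T).
Hypothesis mA : forall j, measurable (A j).

Lemma measurable_mixed :
  measurable [set w | (exists j, A j w) /\ (exists j, ~ A j w)].
Proof.
rewrite (_ : [set w | _] = \bigcup_j A j `&` \bigcup_j ~` A j).
  apply: measurableI; apply: fin_bigcup_measurable => // j _.
  exact: measurableC.
apply/seteqP; split => w /=.
  by case=> -[j Aj] [k Ak]; split; [exists j|exists k].
by case=> -[j _ Aj] [k _ Ak]; split; [exists j|exists k].
Qed.

(** The complement splits into the events that all and that none of the [A j] occur, which are
    disjoint as there is at least one index. *)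
Lemma prob_mixed : (0 < p)%N ->
  fine (P [set w | (exists j, A j w) /\ (exists j, ~ A j w)]) =
  1 - fine (P [set w | forall j, A j w]) - fine (P [set w | forall j, ~ A j w]).
Proof.
move=> p0.
have mAll : measurable [set w | forall j, A j w] by exact: measurable_forall.
have mNone : measurable [set w | forall j, ~ A j w].
  by apply: (@measurable_forall _ _ _ (fun j => ~` A j)) => j; exact: measurableC.
rewrite (_ : [set w | _ /\ _] =
    ~` ([set w | forall j, A j w] `|` [set w | forall j, ~ A j w])).
  rewrite probC; last exact: measurableU.
  rewrite measureU//; last first.
    by apply/seteqP; split => w //= [/(_ (Ordinal p0)) Aw /(_ (Ordinal p0))].
  by rewrite fineD ?prob_fin_num// opprD addrA.
apply/seteqP; split => w /=.
  by case=> -[j Aj] [k Ak] [/(_ k)|/(_ j)].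
move=> /not_orP[/existsNP ? nA]; split => //.
by apply: contrapT => /forallNP.
Qed.

End MixedProbability.

Section BlockTuples.
Context (disp : measure_display) (T : measurableType disp) (R : realType)
        (P : probability T R) (d p : nat) (I : 'I_p -> {set 'I_d}).

(** Independence and equality in law are stated for the tuples [subvec]; boxes present block events
    as preimages of measurable sets of tuples. *)
Definition tuple_box n (c : R) : set (n.-tuple R) := [set t | forall k, tnth t k <= c].

Lemma measurable_tuple_box n c : measurable (@tuple_box n c).
Proof.
apply: (@measurable_forall _ _ _ (fun k => [set t : n.-tuple R | tnth t k <= c])) => k.
rewrite (_ : [set t | _] = (fun t : n.-tuple R => tnth t k) @^-1` `]-oo, c]).
  rewrite -[X in measurable X]setTI; apply: measurable_tnth => //.
by apply/seteqP; split => t /=; rewrite in_itv.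
Qed.

Lemma tuple_box_subvec (Z : 'I_d -> {RV P >-> R}) (c : 'I_p -> R) j w :
  tuple_box (c j) (subvec Z (I j) w) <-> block_event Z I c j w.
Proof.
split => [Zw i ij|Zw k]; last by rewrite tnth_mktuple; apply: Zw; exact: enum_valP.
by have := Zw (enum_rank_in ij i); rewrite tnth_mktuple enum_rankK_in.
Qed.

End BlockTuples.

Lemma eq_law_block_event (disp disp' : measure_display) (T : measurableType disp)
    (T' : measurableType disp') (R : realType) (P : probability T R)
    (P' : probability T' R) (d p : nat) (I : 'I_p -> {set 'I_d})
    (Z : 'I_d -> {RV P >-> R}) (Z' : 'I_d -> {RV P' >-> R}) (c : 'I_p -> R) j :
  eq_law_on Z Z' (I j) ->
  P (block_event Z I c j) = P' (block_event Z' I c j).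
Proof.
move=> /(_ _ (@measurable_tuple_box R _ (c j))).
rewrite (_ : [set w | _] = block_event Z I c j); last first.
  by apply/seteqP; split => w /tuple_box_subvec.
rewrite (_ : [set w | _] = block_event Z' I c j)//.
by apply/seteqP; split => w /tuple_box_subvec.
Qed.

Section Independent.
Context (disp : measure_display) (T : measurableType disp) (R : realType)
        (P : probability T R) (d p : nat) (Z : 'I_d -> {RV P >-> R}).
Context (I : 'I_p -> {set 'I_d}) (indepZ : independent_blocks I Z).

Let indep_fine (B : forall j : 'I_p, set (#|I j|.-tuple R)) (E : 'I_p -> set T) :
  (forall j, measurable (B j)) -> (forall j, measurable (E j)) ->
  (forall j w, B j (subvec Z (I j) w) <-> E j w) ->
  fine (P [set w | forall j, E j w]) = \prod_j fine (P (E j)).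
Proof.
move=> mB mE BE.
rewrite (_ : [set w | _] = [set w | forall j, B j (subvec Z (I j) w)]); last first.
  by apply/seteqP; split => w /= Ew j; apply/BE.
rewrite indepZ// (eq_bigr (fun j => (fine (P (E j)))%:E)) => [|j _].
  by rewrite -(big_morph EFin EFinM erefl).
rewrite fineK ?prob_fin_num//; congr (P _).
by apply/seteqP; split => w /BE.
Qed.

Lemma independent_block_event c :
  fine (P [set w | forall j, block_event Z I c j w]) =
  \prod_j fine (P (block_event Z I c j)).
Proof.
apply: (@indep_fine (fun j => tuple_box (c j))) => [j|j|j w].
- exact: measurable_tuple_box.
- exact: measurable_block_event.
- exact: tuple_box_subvec.
Qed.

Lemma independent_block_eventC c :
  fine (P [set w | forall j, ~ block_event Z I c j w]) =
  \prod_j (1 - fine (P (block_event Z I c j))).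
Proof.
under eq_bigr do rewrite -(probC P (measurable_block_event Z I c _)).
apply: (@indep_fine (fun j => ~` tuple_box (c j))
  (fun j => ~` block_event Z I c j)) => [j|j|j w].
- by apply: measurableC; exact: measurable_tuple_box.
- by apply: measurableC; exact: measurable_block_event.
- by split; apply: contra_not => /tuple_box_subvec.
Qed.

End Independent.

Section TotallyDependent.
Context (disp : measure_display) (T : measurableType disp) (R : realType)
        (P : probability T R) (d p : nat) (Z : 'I_d -> {RV P >-> R}).
Context (I : 'I_p -> {set 'I_d}) (totdepZ : totally_dependent_blocks I Z).
Hypothesis frechetZ : forall i, unit_frechet (Z i).
Hypothesis disjI : forall j k, j != k -> (I j :&: I k)%SET = finset.set0.

(** Total dependence concerns full vectors only, so the coordinates outside [S] are padded by a
    level [m] with [d%:R / m <= e]. *)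
Lemma sub_cdf_totally_dependent (S : {set 'I_d}) x b :
  (forall j, b <= fine (sub_cdf Z (S :&: I j)%SET x)) ->
  b <= fine (sub_cdf Z S x).
Proof.
move=> bS; apply/ler_addgt0Pr => e e0.
pose m : R := d.+1%:R / e.
have m0 : 0 < m by rewrite divr_gt0.
have dm : d%:R / m <= e.
  rewrite /m invf_div mulrCA ger_pMr// ler_pdivrMr// mul1r ler_nat; exact: leqnSn.
rewrite -lerBlDr; apply: le_trans (sub_cdf_pad_le Z S x m).
rewrite -lee_fin fineK; last by rewrite -sub_cdfT sub_cdf_fin_num.
rewrite totdepZ; apply/bigmin_geP; split => [|j _]; first exact: leey.
rewrite -[leRHS]fineK ?sub_cdf_fin_num// lee_fin.
apply: le_trans (sub_cdf_pad_ge frechetZ S (I j) x m0).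
by rewrite lerB.
Qed.

Hypothesis I_neq0 : forall j, I j != finset.set0.

Let mE c j : measurable (block_event Z I c j).
Proof. exact: measurable_block_event. Qed.
Hint Resolve mE : core.

Lemma totally_dependent_block_event c b (J : {set 'I_p}) :
  (forall j, j \in J -> b <= fine (P (block_event Z I c j))) -> b <= 1 ->
  b <= fine (P [set w | forall j, j \in J -> block_event Z I c j w]).
Proof.
move=> bE b1.
have xE j i : i \in I j -> block_level I c i = c j by exact: block_levelE.
rewrite (joint_block_event _ _ xE); apply: sub_cdf_totally_dependent => k.
have [kJ|kJ] := boolP (k \in J).
  apply: le_trans (bE k kJ) _; rewrite (block_event_sub_cdf _ (xE k)).
  by apply: fine_sub_cdf_le => //; exact: finset.subsetIr.
(* A block outside [J] constrains no coordinate and has probability 1, whence the condition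
   [b <= 1]. *)
rewrite (_ : _ :&: _ = finset.set0)%SET.
  rewrite /sub_cdf (_ : [set w | _] = setT) ?probability_setT//.
  by apply/seteqP; split => w //= _ i; rewrite inE.
apply/setP => i; rewrite !inE; apply/negP => /andP[/finset.bigcupP[j jJ ij] ik].
have jk : j != k by apply: contraNneq kJ => <-.
by have /setP/(_ i) := disjI jk; rewrite !inE ij ik.
Qed.

(** Total dependence puts each block event inside the most probable one, up to a null set [C j]. Off
    these null sets, failure of the event of [j0] entails failure of all. *)
Lemma totally_dependent_block_eventC c j0 :
  (forall j, fine (P (block_event Z I c j)) <= fine (P (block_event Z I c j0))) ->
  fine (P (~` block_event Z I c j0)) <=
  fine (P [set w | forall j, ~ block_event Z I c j w]).
Proof.
move=> j0max.
pose C j := block_event Z I c j `\` block_event Z I c j0.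
have mC j : measurable (C j) by exact: measurableD.
have C0 j : fine (P (C j)) <= 0.
  rewrite probD// subr_le0.
  rewrite (_ : _ `&` _ =
      [set w | forall k, k \in [set j; j0]%SET -> block_event Z I c k w]).
    apply: totally_dependent_block_event; last exact: prob_le1.
    by move=> k; rewrite !inE => /orP[] /eqP ->.
  apply/seteqP; split => w /=.
    by move=> [Zj Zj0] k; rewrite !inE => /orP[] /eqP ->.
  by move=> Zw; split; apply: Zw; rewrite !inE eqxx ?orbT.
have mG : measurable [set w | forall j, j \in [set: 'I_p]%SET -> ~ C j w].
  by apply: (@measurable_forall_in _ _ _ _ (fun j => ~` C j)) => j; exact: measurableC.
apply: (le_trans (prob_le_except P _ _ mG
    (B := [set w | forall j, ~ block_event Z I c j w]) _)).
- exact: measurableC.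
- apply: (@measurable_forall _ _ _ (fun j => ~` block_event Z I c j)) => j.
  exact: measurableC.
- by move=> w [/= Zj0 Gw] j Zj; apply: (Gw j); rewrite ?inE.
rewrite gerDl; apply: (le_trans (prob_union_bound P mC _)).
exact: sumr_le0.
Qed.

(** For coordinates in different blocks, being at most [c] is almost surely the same event. A mixed
    outcome would separate a coordinate of a satisfied block from one exceeding [c] in another
    block. *)
Lemma totally_dependent_mixed0 (c : R) :
  P [set w | (exists j, block_event Z I (fun=> c) j w) /\
             (exists j, ~ block_event Z I (fun=> c) j w)] = 0%E.
Proof.
pose Q : {set 'I_d * 'I_d} :=
  [set ik | [exists j, exists k, [&& j != k, ik.1 \in I j & ik.2 \in I k]]]%SET.
pose C (ik : 'I_d * 'I_d) := [set w | Z ik.1 w <= c] `\` [set w | Z ik.2 w <= c].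
have mZ i : measurable [set w | Z i w <= c] by exact: measurable_RV_le.
have mC ik : measurable (C ik) by exact: measurableD.
have C0 ik : ik \in Q -> fine (P (C ik)) <= 0.
  rewrite inE => /existsP[j /existsP[k /and3P[jk ij kk]]].
  rewrite probD// subr_le0.
  rewrite (_ : _ `&` _ = [set w | forall i, i \in [set ik.1; ik.2]%SET -> Z i w <= c]).
    rewrite unit_frechet_cdf//.
    apply: (sub_cdf_totally_dependent (x := fun=> c)) => l.
    (* Each block contains at most one of the two coordinates, and all margins take the same value
       at [c]. *)
    have single (i0 : 'I_d) : ([set ik.1; ik.2] :&: I l \subset [set i0])%SET ->
        frechet_cdf c <= fine (sub_cdf Z ([set ik.1; ik.2] :&: I l)%SET (fun=> c)).
      move=> sub; rewrite -(unit_frechet_cdf frechetZ i0).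
      apply: prob_le => //; first exact: (@measurable_sub_event _ _ _ _ _ _ _ (fun=> c)).
      by move=> w /= Zi0 i /(fintype.subsetP sub); rewrite inE => /eqP ->.
    have [lj|lj] := eqVneq l j.
      apply: (single ik.1); apply/fintype.subsetP => i; rewrite !inE => /andP[/orP[//|/eqP ->]].
      rewrite lj => kj; have /setP/(_ ik.2) := disjI jk.
      by rewrite !inE kj kk.
    apply: (single ik.2); apply/fintype.subsetP => i; rewrite !inE => /andP[/orP[/eqP ->|//]].
    move=> il; have /setP/(_ ik.1) := disjI lj.
    by rewrite !inE ij il.
  apply/seteqP; split => w /=.
    by move=> [Z1 Z2] i; rewrite !inE => /orP[] /eqP ->.
  by move=> Zw; split; apply: Zw; rewrite !inE eqxx ?orbT.
have mM := measurable_mixed (mE (fun=> c)).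
have mG : measurable [set w | forall ik, ik \in Q -> ~ C ik w].
  by apply: (@measurable_forall_in _ _ _ _ (fun j => ~` C j)) => j; exact: measurableC.
apply/eqP; rewrite eq_le measure_ge0 andbT.
rewrite -[leLHS]fineK ?prob_fin_num// lee_fin.
apply: (le_trans (prob_le_except P mM measurable0 mG _)).
  move=> w [/= [[j Zj] [k /existsNP[i /not_implyP[ik Zi]]]] Gw].
  have /set0Pn[i0 i0j] := I_neq0 j.
  have jk : j != k by apply: contra_notN Zi => /eqP jk; apply: Zj; rewrite jk.
  apply: (Gw (i0, i)); last by split; [exact: Zj|exact: Zi].
  by rewrite inE; apply/existsP; exists j; apply/existsP; exists k; rewrite jk i0j.
rewrite measure0 add0r; apply: (le_trans (prob_union_bound P mC _)).
exact: sumr_le0.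
Qed.

End TotallyDependent.

(** * Comparison of coefficients and the closed form *)

Lemma le_max_min_coef (disp disp' : measure_display) (T : measurableType disp)
    (T' : measurableType disp') (R : realType) (P : probability T R)
    (P' : probability T' R) (d p : nat) (I : 'I_p -> {set 'I_d})
    (lambda : 'I_p -> R) (Z : 'I_d -> {RV P >-> R}) (Z' : 'I_d -> {RV P' >-> R}) :
  (0 < p)%N -> (forall j, 0 < lambda j) ->
  (forall c, (forall j, 0 < c j) ->
    fine (P' [set w | forall j, block_event Z' I c j w]) <=
    fine (P [set w | forall j, block_event Z I c j w])) ->
  (forall c, (forall j, 0 < c j) ->
    fine (P' [set w | forall j, ~ block_event Z' I c j w]) <=
    fine (P [set w | forall j, ~ block_event Z I c j w])) ->
  (max_min_coef I Z lambda <= max_min_coef I Z' lambda)%E.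
Proof.
move=> p0 lam0 all_le none_le.
have [-> mZ] := max_min_coefE Z I lam0 p0.
have [-> mZ'] := max_min_coefE Z' I lam0 p0.
apply: ge0_le_integral => // u; rewrite /= in_itv/= => /andP[u0 u1].
have c0 j : 0 < lambda j / - ln u by rewrite divr_gt0// oppr_gt0 ln_lt0// u0.
have mE j := measurable_block_event Z I (fun j => lambda j / - ln u) j.
have mE' j := measurable_block_event Z' I (fun j => lambda j / - ln u) j.
rewrite -[leLHS]fineK ?prob_fin_num//; last exact: measurable_mixed.
rewrite -[leRHS]fineK ?prob_fin_num//; last exact: measurable_mixed.
rewrite lee_fin !prob_mixed// lerB ?none_le//.
by rewrite lerB ?all_le.
Qed.

(** At the level [c = 1 / - ln u] the value [expR (- (eps / c))] given by [sub_cdf_cst] is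
    [expR (eps * ln u)], where [eps] is the extremal coefficient. *)
Lemma frechet_block_event_powR (disp : measure_display) (T : measurableType disp)
    (R : realType) (P : probability T R) (d p : nat) (Z : 'I_d -> {RV P >-> R})
    (I : 'I_p -> {set 'I_d}) (u : R) j :
  unit_frechet_MEV Z -> 0 < u < 1 ->
  fine (P (block_event Z I (fun=> 1 / - ln u) j)) = u `^ extremal_coef Z (I j).
Proof.
move=> [frZ stZ] /andP[u0 u1].
have lnu : 0 < - ln u by rewrite oppr_gt0 ln_lt0// u0.
rewrite (block_event_sub_cdf Z (x := fun=> 1 / - ln u))//.
rewrite (sub_cdf_cst frZ stZ) ?divr_gt0//.
by rewrite div1r invrK mulrN opprK /powR gt_eqF.
Qed.

Lemma prod_powR (R : realType) (I : finType) (Q : pred I) (u : R) (e : I -> R) :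
  0 < u -> \prod_(j | Q j) u `^ e j = u `^ (\sum_(j | Q j) e j).
Proof.
move=> u0; elim/big_rec2: _ => [|j x y _ ->]; first by rewrite powRr0.
by rewrite powRD// (gt_eqF u0) implybT.
Qed.

Section IndependentCoefficient.
Context (R : realType) (p : nat) (p_gt0 : (0 < p)%N) (e : 'I_p -> R).

(** The sign comes from expanding the product of the [1 - u ^ e j], whose empty term cancels the
    leading 1; the correction at the full set is the probability that all block events occur. *)
Let a (S : {set 'I_p}) : R := (-1) ^+ #|S|.+1 - (S == [set: 'I_p]%SET)%:R.

Let setT_neq0 : [set: 'I_p]%SET != finset.set0.
Proof. by apply/set0Pn; exists (Ordinal p_gt0); rewrite inE. Qed.

Let sum_setT : \sum_(j in [set: 'I_p]%SET) e j = \sum_j e j.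
Proof. by apply: eq_bigl => j; rewrite inE. Qed.

Lemma independent_integrandE (u : R) : 0 < u ->
  1 - \prod_j u `^ e j - \prod_j (1 - u `^ e j) =
  \sum_(S : {set 'I_p} | S != finset.set0) a S * u `^ (\sum_(j in S) e j).
Proof.
move=> u0; rewrite prod_1B (bigD1 finset.set0)//= cards0 expr0 mul1r.
rewrite finset.big_set0.
rewrite /a; under [RHS]eq_bigr do rewrite mulrBl.
rewrite sumrB [X in _ = _ - X](bigD1 [set: 'I_p]%SET)//= eqxx mul1r.
rewrite [X in _ = _ - (_ + X)]big1 => [|S /andP[_ /negbTE ->]]; last by rewrite mul0r.
rewrite addr0 prod_powR// sum_setT.
rewrite (eq_bigr (fun S : {set 'I_p} =>
  - ((-1) ^+ #|S|.+1 * u `^ (\sum_(j in S) e j)))) => [|S _].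
  by rewrite sumrN; ring.
by rewrite exprS mulN1r mulNr opprK prod_powR.
Qed.

(** Each ratio [s / (1 + s)] is [1 - (1 + s)^-1]; the constants cancel because the signs over
    nonempty sets sum to 1. *)
Lemma independent_integralE : (forall j, 0 <= e j) ->
  \sum_(S : {set 'I_p} | S != finset.set0) a S / (1 + \sum_(j in S) e j) =
  (\sum_(j < p) e j) / (1 + \sum_(j < p) e j) -
  \sum_(S : {set 'I_p} | S != finset.set0)
    (-1) ^+ #|S|.+1 * ((\sum_(j in S) e j) / (1 + \sum_(j in S) e j)).
Proof.
move=> e0.
have ratioE (Q : pred 'I_p) : (\sum_(j | Q j) e j) / (1 + \sum_(j | Q j) e j) =
    1 - (1 + \sum_(j | Q j) e j)^-1.
  have : 0 <= \sum_(j | Q j) e j by exact: sumr_ge0.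
  move: (\sum_(j | Q j) e j) => s s0; field; lra.
rewrite ratioE; under [X in _ = _ - X]eq_bigr do rewrite ratioE mulrBr mulr1.
rewrite /a; under [LHS]eq_bigr do rewrite mulrBl.
rewrite !sumrB [X in _ - X = _](bigD1 [set: 'I_p]%SET)//= eqxx mul1r.
rewrite [X in _ - (_ + X) = _]big1 => [|S /andP[_ /negbTE ->]]; last by rewrite mul0r.
rewrite addr0 sum_setT.
have : \sum_(S : {set 'I_p}) (-1) ^+ #|S| = 0 :> R.
  transitivity (\sum_(S : {set 'I_p} | S \subset [set: 'I_p]%SET) (-1) ^+ #|S| : R).
    by apply: eq_bigl => S; rewrite finset.subsetT.
  by rewrite sum_sign_subset (negbTE setT_neq0).
rewrite (bigD1 finset.set0)//= cards0 expr0 => sgn.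
have -> : \sum_(S : {set 'I_p} | S != finset.set0) (-1) ^+ #|S|.+1 = 1 :> R.
  under eq_bigr do rewrite exprS mulN1r.
  by rewrite sumrN; lra.
by ring.
Qed.

End IndependentCoefficient.

Theorem proposition2p3 (R : realType) (d p : nat) (d_gt0 : (0 < d)%N)
    (I : 'I_p -> {set 'I_d}) (partI : is_partition I)
    (lambda : 'I_p -> R) (lambda_gt0 : forall j, 0 < lambda j)
    (disp : measure_display) (T : measurableType disp) (P : probability T R)
    (disph : measure_display) (Th : measurableType disph)
    (Ph : probability Th R)
    (dispb : measure_display) (Tb : measurableType dispb)
    (Pb : probability Tb R)
    (X : 'I_d -> {RV P >-> R}) (Xhat : 'I_d -> {RV Ph >-> R})
    (Xbar : 'I_d -> {RV Pb >-> R})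
    (mevX : unit_frechet_MEV X) (mevXhat : unit_frechet_MEV Xhat)
    (mevXbar : unit_frechet_MEV Xbar)
    (indepXhat : independent_blocks I Xhat)
    (totdepXbar : totally_dependent_blocks I Xbar)
    (lawXhat : forall j, eq_law_on Xhat X (I j))
    (lawXbar : forall j, eq_law_on Xbar X (I j)) :
  [/\ (max_min_coef I Xbar lambda <= max_min_coef I X lambda)%E /\
      (max_min_coef I X lambda <= max_min_coef I Xhat lambda)%E,
      max_min_coef I Xbar (fun=> 1) = 0%E
    & max_min_coef I Xhat (fun=> 1) =
      (let eps j := extremal_coef X (I j) in
       (\sum_(j < p) eps j) / (1 + \sum_(j < p) eps j) -
       \sum_(A : {set 'I_p} | A != finset.set0)
          (-1) ^+ #|A|.+1 *
          ((\sum_(j in A) eps j) / (1 + \sum_(j in A) eps j)))%:E].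
Proof.
have [I_neq0 disjI coverI] := partI.
have p_gt0 : (0 < p)%N.
  have : Ordinal d_gt0 \in (\bigcup_(j < p) I j)%SET by rewrite coverI inE.
  by move=> /finset.bigcupP[[j jp] _ _]; exact: leq_ltn_trans jp.
have one_gt0 (j : 'I_p) : 0 < (1 : R) by [].
have hatE c j : fine (Ph (block_event Xhat I c j)) = fine (P (block_event X I c j)).
  by rewrite (eq_law_block_event c (lawXhat j)).
have barE c j : fine (Pb (block_event Xbar I c j)) = fine (P (block_event X I c j)).
  by rewrite (eq_law_block_event c (lawXbar j)).
have [frbar _] := mevXbar.
have mE c j := measurable_block_event X I c j.
split; first split.
- apply: le_max_min_coef => // c c0.
  + have all_setT (T' : Type) (E : 'I_p -> set T') :
        [set w | forall j, E j w] = [set w | forall j, j \in [set: 'I_p]%SET -> E j w].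
      apply/seteqP; split => w /= Ew j => [_|]; first exact: Ew.
      by apply: Ew; rewrite inE.
    (* The bound [b] is the probability for [X] that all block events occur, which is below each
       block probability, shared with [Xbar]. *)
    rewrite [in leRHS]all_setT; apply: totally_dependent_block_event => //.
      move=> j _; rewrite barE; apply: prob_le => //; exact: measurable_forall.
    by apply: prob_le1; exact: measurable_forall.
  + pose j1 : 'I_p := Ordinal p_gt0.
    pose prE j := fine (Pb (block_event Xbar I c j)).
    (* For the most probable block [j0], the probability for [X] that none occurs is at most that of
       missing [j0], which is the same for [Xbar]. *)
    case: (@arg_maxP _ _ _ j1 predT prE) => // j0 _ j0max.
    apply: (@le_trans _ _ (fine (P (~` block_event X I c j0)))).
      apply: prob_le; [|exact: measurableC|by move=> w; apply].
      apply: (@measurable_forall _ _ _ (fun j => ~` block_event X I c j)) => j.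
      exact: measurableC.
    rewrite probC// -barE -probC; last exact: measurable_block_event.
    by apply: totally_dependent_block_eventC => // j; exact: j0max.
- apply: le_max_min_coef => // c c0.
  + rewrite independent_block_event//; under eq_bigr do rewrite hatE.
    exact: prob_block_event_le.
  + rewrite independent_block_eventC//.
    under eq_bigr do rewrite hatE -(probC P (mE c _)).
    exact: prob_block_eventC_le.
- have [-> _] := max_min_coefE Xbar I one_gt0 p_gt0.
  rewrite integral0_eq// => u _.
  (* With all exponents equal to 1 the block levels coincide, so the integrand vanishes at each
     [u]. *)
  exact: (totally_dependent_mixed0 totdepXbar).
have [-> _] := max_min_coefE Xhat I one_gt0 p_gt0.
pose eps j := extremal_coef X (I j).
have eps_ge0 j : 0 <= eps j by exact: extremal_coef_ge0.
(* This intermediate form is the termwise integral of the powers of [u] in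
   [independent_integrandE]. *)
transitivity (\sum_(S : {set 'I_p} | S != finset.set0)
    ((-1) ^+ #|S|.+1 - (S == [set: 'I_p]%SET)%:R) / (1 + \sum_(j in S) eps j))%:E;
  last by rewrite independent_integralE.
rewrite -integral_sum_powR; last by move=> S; exact: sumr_ge0.
apply: eq_integral => u; rewrite inE/= in_itv/= => u01.
have /andP[u0 _] := u01.
rewrite -independent_integrandE//.
rewrite -[LHS]fineK; last first.
  by apply: prob_fin_num; apply: measurable_mixed => j; exact: measurable_block_event.
rewrite prob_mixed//; last by move=> j; exact: measurable_block_event.
rewrite independent_block_event// independent_block_eventC//.
under [X in 1 - X - _]eq_bigr do rewrite hatE frechet_block_event_powR//.
by under [X in _ - X]eq_bigr do rewrite hatE frechet_block_event_powR//.
Qed.
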